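(* Let $f(x)=a_rx^r+\cdots+a_1x+a_0$ be a non-constant polynomial with integer coefficients and with $a_r\ge 1$. Then for every colouring of $\mathbb{R}^2$ with finitely many colours, there exist two distinct points of the same colour whose Euclidean distance from each other is equal to $f(n)$ for some integer $n$. *)

(* Defs.v *)
From Stdlib Require Import Reals List ZArith.
Open Scope R_scope.

Fixpoint zpoly_eval (cs : list Z) (x : R) : R :=
  match cs with
  | nil => 0
  | a :: cs' => IZR a + x * zpoly_eval cs' x
  end.

Definition dist2 (p q : R * R) : R :=
  sqrt ((fst p - fst q) ^ 2 + (snd p - snd q) ^ 2).

(* Main.v *)
Require Import Defs.
From Stdlib Require Import Reals List ZArith.
From Stdlib Require Import Lra Lia Classical ClassicalEpsilon FinFun.
Open Scope R_scope.

(* Fix [eps]. By van der Corput differencing there are [W >= 1] and [C] such that the average of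
   [exp(2 i pi al f(n))] over [N] consecutive [n] has real part at least [- eps] unless [W al] is
   within [C / N] of an integer. Let [omega] have modulus 1 and real part [1 / (2 W)]. For a character
   of the lattice containing [omega, ..., omega^m], the values [al_j] at [omega^j] satisfy
   [W (al_(j+2) + al_j) = al_(j+1)], which forces [al_j] to be nearly an integer as soon as
   [W al_i], [W al_j], [W al_l] are, for some [i < j < l]. So at most two of the [al_j] are near a
   non-integral multiple of [1 / W]. Averaging also over [T] lacunary values of [N], to handle the
   [al_j] near an integer, yields a probability measure on the vectors [f(n) omega^j] whose Fourier
   transform is at least [- (2 / m + 1 / T + eps)]. The ratio bound, applied to a box of the lattice
   inside a finite cyclic group squared, then excludes a colouring with few colours. *)

(** * Finite sums *)

Definition lsum {A : Type} (f : A -> R) (l : list A) : R :=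
  fold_right (fun a s => f a + s) 0 l.

Lemma lsum_ext {A} (f g : A -> R) l :
  (forall x, In x l -> f x = g x) -> lsum f l = lsum g l.
Proof.
induction l as [|x l IH]; simpl; intros H; [reflexivity|].
rewrite H by auto. rewrite IH; auto.
Qed.

Lemma lsum_le {A} (f g : A -> R) l :
  (forall x, In x l -> f x <= g x) -> lsum f l <= lsum g l.
Proof.
induction l as [|x l IH]; simpl; intros H; [lra|].
assert (f x <= g x) by auto. assert (lsum f l <= lsum g l) by auto. lra.
Qed.

Lemma lsum_plus {A} (f g : A -> R) l :
  lsum (fun x => f x + g x) l = lsum f l + lsum g l.
Proof. induction l as [|x l IH]; simpl; [ring|rewrite IH; ring]. Qed.

Lemma lsum_scal {A} (c : R) (f : A -> R) l :
  lsum (fun x => c * f x) l = c * lsum f l.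
Proof. induction l as [|x l IH]; simpl; [ring|rewrite IH; ring]. Qed.

Lemma lsum_minus {A} (f g : A -> R) l :
  lsum (fun x => f x - g x) l = lsum f l - lsum g l.
Proof. induction l as [|x l IH]; simpl; [ring|rewrite IH; ring]. Qed.

Lemma lsum_const {A} (c : R) (l : list A) :
  lsum (fun _ => c) l = INR (length l) * c.
Proof.
induction l as [|x l IH]; [simpl; ring|].
change (c + lsum (fun _ => c) l = INR (S (length l)) * c).
rewrite IH, S_INR; ring.
Qed.

Lemma lsum_zero {A} (f : A -> R) l :
  (forall x, In x l -> f x = 0) -> lsum f l = 0.
Proof. intros H. rewrite (lsum_ext f (fun _ => 0) l H), lsum_const; ring. Qed.

Lemma lsum_nonneg {A} (f : A -> R) l :
  (forall x, In x l -> 0 <= f x) -> 0 <= lsum f l.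
Proof.
intros H. apply Rle_trans with (lsum (fun _ => 0) l); [|now apply lsum_le].
rewrite lsum_const; lra.
Qed.

Lemma lsum_swap {A B} (f : A -> B -> R) l l' :
  lsum (fun x => lsum (f x) l') l = lsum (fun y => lsum (fun x => f x y) l) l'.
Proof.
induction l as [|x l IH]; simpl.
- symmetry; now apply lsum_zero.
- rewrite IH, <- lsum_plus. reflexivity.
Qed.

Lemma lsum_app {A} (f : A -> R) l l' : lsum f (l ++ l') = lsum f l + lsum f l'.
Proof. induction l as [|x l IH]; simpl; [ring|rewrite IH; ring]. Qed.

Lemma lsum_map {A B} (f : B -> R) (h : A -> B) l :
  lsum f (map h l) = lsum (fun x => f (h x)) l.
Proof. induction l as [|x l IH]; simpl; [reflexivity|now rewrite IH]. Qed.

Lemma lsum_list_prod {A B} (f : A * B -> R) l l' :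
  lsum f (list_prod l l') = lsum (fun x => lsum (fun y => f (x, y)) l') l.
Proof.
induction l as [|x l IH]; simpl; [reflexivity|].
now rewrite lsum_app, lsum_map, IH.
Qed.

Lemma lsum_mult {A B} (f : A -> R) (g : B -> R) l l' :
  lsum f l * lsum g l' = lsum (fun x => lsum (fun y => f x * g y) l') l.
Proof.
rewrite Rmult_comm, <- lsum_scal. apply lsum_ext; intros x _.
rewrite lsum_scal; ring.
Qed.

Lemma lsum_ge_term {A} (f : A -> R) l a :
  (forall x, In x l -> 0 <= f x) -> In a l -> f a <= lsum f l.
Proof.
induction l as [|x l IH]; simpl; intros H Ha; [contradiction|].
assert (Hl : 0 <= lsum f l) by (apply lsum_nonneg; auto).
destruct Ha as [->|Ha]; [lra|].
assert (0 <= f x) by auto. assert (f a <= lsum f l) by auto. lra.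
Qed.

Lemma lsum_abs_le {A} (f : A -> R) l c :
  (forall x, In x l -> Rabs (f x) <= c) -> Rabs (lsum f l) <= INR (length l) * c.
Proof.
intros H. rewrite <- (lsum_const c l). induction l as [|x l IH].
- simpl. rewrite Rabs_R0; lra.
- simpl. eapply Rle_trans; [apply Rabs_triang|].
  apply Rplus_le_compat; [apply H; now left|apply IH; intros; apply H; now right].
Qed.

Lemma lsum_seq_S (f : nat -> R) n :
  lsum f (seq 0 (S n)) = lsum f (seq 0 n) + f n.
Proof. rewrite seq_S, lsum_app; simpl; ring. Qed.

Lemma lsum_cauchy_schwarz {A} (f : A -> R) l :
  lsum f l * lsum f l <= INR (length l) * lsum (fun x => f x * f x) l.
Proof.
induction l as [|x l IH]; [simpl; lra|].
change (length (x :: l)) with (S (length l)). rewrite S_INR. simpl.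
set (s := lsum f l) in *. set (q := lsum (fun x => f x * f x) l) in *.
pose proof (pos_INR (length l)) as Hn. set (n := INR (length l)) in *.
assert (Hq : 0 <= q) by (apply lsum_nonneg; intros; nra).
assert (H : 2 * (f x * s) <= n * (f x * f x) + q).
{ destruct (Req_dec n 0) as [Hz|Hz].
  - assert (s = 0) by nra. rewrite Hz, H; lra.
  - assert (Hp : 0 < n) by lra. apply Rmult_le_reg_l with n; [lra|].
    pose proof (Rle_0_sqr (n * f x - s)) as Hs; unfold Rsqr in Hs. nra. }
nra.
Qed.

(** * Exponential sums *)

Definition cs (x : R) : R := cos (2 * PI * x).
Definition sn (x : R) : R := sin (2 * PI * x).

Lemma cs_minus x y : cs (x - y) = cs x * cs y + sn x * sn y.
Proof. unfold cs, sn. rewrite Rmult_minus_distr_l. apply cos_minus. Qed.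

Lemma cs_plus x y : cs (x + y) = cs x * cs y - sn x * sn y.
Proof. unfold cs, sn. rewrite Rmult_plus_distr_l. apply cos_plus. Qed.

Lemma cs_opp x : cs (- x) = cs x.
Proof.
unfold cs. rewrite <- (cos_neg (2 * PI * x)). f_equal; ring.
Qed.

Lemma cs_0 : cs 0 = 1.
Proof. unfold cs. rewrite Rmult_0_r. apply cos_0. Qed.

Lemma cs_bound x : -1 <= cs x <= 1.
Proof. apply COS_bound. Qed.

Lemma sn_bound x : -1 <= sn x <= 1.
Proof. apply SIN_bound. Qed.

Lemma cs_period_nat x n : cs (x + INR n) = cs x.
Proof.
unfold cs. rewrite <- (cos_period (2 * PI * x) n). f_equal; ring.
Qed.

Lemma cs_period x z : cs (x + IZR z) = cs x.
Proof.
destruct (Z_le_gt_dec 0 z) as [Hz|Hz].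
- rewrite <- (Z2Nat.id z Hz), <- INR_IZR_INZ. apply cs_period_nat.
- rewrite <- (cs_period_nat (x + IZR z) (Z.to_nat (- z))).
  rewrite INR_IZR_INZ, Z2Nat.id, opp_IZR by lia. f_equal; ring.
Qed.

Lemma sn_period_nat x n : sn (x + INR n) = sn x.
Proof.
unfold sn. rewrite <- (sin_period (2 * PI * x) n). f_equal; ring.
Qed.

Lemma sn_period x z : sn (x + IZR z) = sn x.
Proof.
destruct (Z_le_gt_dec 0 z) as [Hz|Hz].
- rewrite <- (Z2Nat.id z Hz), <- INR_IZR_INZ. apply sn_period_nat.
- rewrite <- (sn_period_nat (x + IZR z) (Z.to_nat (- z))).
  rewrite INR_IZR_INZ, Z2Nat.id, opp_IZR by lia. f_equal; ring.
Qed.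

(* The squared modulus of [sum_{x in l} exp(2 i pi g(x))]. *)
Definition modsq {A} (g : A -> R) (l : list A) : R :=
  lsum (fun x => cs (g x)) l * lsum (fun x => cs (g x)) l +
  lsum (fun x => sn (g x)) l * lsum (fun x => sn (g x)) l.

Lemma modsq_expand {A} (g : A -> R) l :
  modsq g l = lsum (fun x => lsum (fun y => cs (g x - g y)) l) l.
Proof.
unfold modsq. rewrite !lsum_mult, <- lsum_plus. apply lsum_ext; intros x _.
rewrite <- lsum_plus. apply lsum_ext; intros y _. now rewrite cs_minus.
Qed.

Lemma modsq_nonneg {A} (g : A -> R) l : 0 <= modsq g l.
Proof. unfold modsq. nra. Qed.

(** Multiplying by [sin (PI * b)] turns each term into a difference of sines, so the sum telescopes.
    Since nothing is divided, integral [b] needs no separate case. *)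
Lemma geometric_cs x b N :
  sin (PI * b) * lsum (fun n => cs (x + INR n * b)) (seq 0 N) =
  (sn (x + INR N * b - b / 2) - sn (x - b / 2)) / 2.
Proof.
induction N as [|N IH].
- simpl. rewrite Rmult_0_l, Rplus_0_r. lra.
- rewrite lsum_seq_S, Rmult_plus_distr_l, IH, S_INR.
  set (y := x + INR N * b).
  replace (x + (INR N + 1) * b - b / 2) with (y + b / 2) by (unfold y; field).
  unfold sn, cs.
  replace (2 * PI * (y + b / 2)) with (2 * PI * y + PI * b) by field.
  replace (2 * PI * (y - b / 2)) with (2 * PI * y - PI * b) by field.
  rewrite sin_plus, sin_minus. field.
Qed.

Lemma geometric_sn x b N :
  sin (PI * b) * lsum (fun n => sn (x + INR n * b)) (seq 0 N) =
  (cs (x - b / 2) - cs (x + INR N * b - b / 2)) / 2.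
Proof.
induction N as [|N IH].
- simpl. rewrite Rmult_0_l, Rplus_0_r. lra.
- rewrite lsum_seq_S, Rmult_plus_distr_l, IH, S_INR.
  set (y := x + INR N * b).
  replace (x + (INR N + 1) * b - b / 2) with (y + b / 2) by (unfold y; field).
  unfold sn, cs.
  replace (2 * PI * (y + b / 2)) with (2 * PI * y + PI * b) by field.
  replace (2 * PI * (y - b / 2)) with (2 * PI * y - PI * b) by field.
  rewrite cos_plus, cos_minus. field.
Qed.

Definition near_int (x d : R) : Prop := exists z : Z, Rabs (x - IZR z) <= d.

Lemma near_int_weaken x d d' : near_int x d -> d <= d' -> near_int x d'.
Proof. intros [z Hz] H; exists z; lra. Qed.

Lemma near_int_plus x y d e :
  near_int x d -> near_int y e -> near_int (x + y) (d + e).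
Proof.
intros [z Hz] [w Hw]. exists (z + w)%Z. rewrite plus_IZR.
replace (x + y - (IZR z + IZR w)) with ((x - IZR z) + (y - IZR w)) by ring.
eapply Rle_trans; [apply Rabs_triang|lra].
Qed.

Lemma near_int_mult n x d :
  near_int x d -> near_int (IZR n * x) (Rabs (IZR n) * d).
Proof.
intros [z Hz]. exists (n * z)%Z. rewrite mult_IZR.
replace (IZR n * x - IZR n * IZR z) with (IZR n * (x - IZR z)) by ring.
rewrite Rabs_mult. apply Rmult_le_compat_l; [apply Rabs_pos|exact Hz].
Qed.

Lemma near_int_half x : near_int x (1 / 2).
Proof.
exists (up (x - 1 / 2)). destruct (archimed (x - 1 / 2)) as [H1 H2].
apply Rabs_le; lra.
Qed.

(** * Weyl sums *)

(* [diff_degree r b g]: [g] is polynomial of degree at most [r] with leading coefficient [b / r!],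
   expressed through iterated differences. *)
Fixpoint diff_degree (r : nat) (b : R) (g : nat -> R) : Prop :=
  match r with
  | O => forall n, g n = b
  | S r' => forall h, diff_degree r' (INR h * b) (fun n => g (n + h)%nat - g n)
  end.

Lemma diff_degree_ext r b b' g g' :
  b = b' -> (forall n, g n = g' n) -> diff_degree r b g -> diff_degree r b' g'.
Proof.
intros <-. revert b g g'. induction r as [|r IH]; simpl; intros b g g' Hg H.
- intros n. now rewrite <- Hg.
- intros h. eapply IH; [|exact (H h)]. intros n; simpl. now rewrite !Hg.
Qed.

Lemma diff_degree_plus r b b' g g' :
  diff_degree r b g -> diff_degree r b' g' ->
  diff_degree r (b + b') (fun n => g n + g' n).
Proof.
revert b b' g g'. induction r as [|r IH]; simpl; intros b b' g g' H H'.
- intros n. now rewrite H, H'.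
- intros h. eapply diff_degree_ext; [| |exact (IH _ _ _ _ (H h) (H' h))].
  + ring.
  + intros n; simpl; ring.
Qed.

Lemma diff_degree_scal r c b g :
  diff_degree r b g -> diff_degree r (c * b) (fun n => c * g n).
Proof.
revert b g. induction r as [|r IH]; simpl; intros b g H.
- intros n. now rewrite H.
- intros h. eapply diff_degree_ext; [| |exact (IH _ _ (H h))].
  + ring.
  + intros n; simpl; ring.
Qed.

Lemma diff_degree_shift r s b g :
  diff_degree r b g -> diff_degree r b (fun n => g (n + s)%nat).
Proof.
revert b g. induction r as [|r IH]; simpl; intros b g H.
- intros n. now rewrite H.
- intros h. eapply diff_degree_ext; [| |exact (IH _ _ (H h))].
  + reflexivity.
  + intros n; simpl. f_equal; f_equal; lia.
Qed.

Lemma diff_degree_const r c : diff_degree (S r) 0 (fun _ => c).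
Proof.
revert c. induction r as [|r IH]; intros c h.
- intros n; ring.
- eapply diff_degree_ext; [| |exact (IH (c - c))]; [ring|reflexivity].
Qed.

(** Product rule for differences: [n * g n] changes by [n] times the change of [g], plus
    [h * g (n + h)]. The leading coefficient [b / r!] is kept, and the factor [S r] accounts for its
    new denominator [(r + 1)!]. *)
Lemma diff_degree_mul_id r b g :
  diff_degree r b g -> diff_degree (S r) (INR (S r) * b) (fun n => INR n * g n).
Proof.
revert b g. induction r as [|r IH]; intros b g H h.
- intros n. simpl in H. rewrite !H, plus_INR. simpl; ring.
- eapply diff_degree_ext with (g := fun n => INR n * (g (n + h)%nat - g n) + INR h * g (n + h)%nat).
  3:{ apply diff_degree_plus; [apply IH, (H h)|].
      apply diff_degree_scal, diff_degree_shift, H. }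
  + rewrite !S_INR; ring.
  + intros n. rewrite plus_INR. simpl; ring.
Qed.

Lemma diff_degree_zpoly (al : R) (a : list Z) (ar : Z) :
  diff_degree (length a) (INR (fact (length a)) * (al * IZR ar))
    (fun n => al * zpoly_eval (a ++ ar :: nil) (INR n)).
Proof.
induction a as [|a0 a IH].
- simpl. intros n; ring.
- change (length (a0 :: a)) with (S (length a)).
  eapply diff_degree_ext with
    (g := fun n => al * IZR a0 + INR n * (al * zpoly_eval (a ++ ar :: nil) (INR n))).
  3:{ apply diff_degree_plus; [apply diff_degree_const|apply diff_degree_mul_id, IH]. }
  + rewrite fact_simpl, mult_INR; ring.
  + intros n. simpl; ring.
Qed.

Lemma Rabs_le_inv x d : Rabs x <= d -> - d <= x <= d.
Proof. unfold Rabs; destruct (Rcase_abs x); lra. Qed.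

(** With [y = PI * x], which is at most 2, the Taylor bound [y - y ^ 3 / 6] is at least [y / 3], and
    [PI] exceeds 3. *)
Lemma half_le_sin x : 0 <= x <= 1 / 2 -> x <= sin (PI * x).
Proof.
intros Hx. pose proof PI_RGT_0 as H0. pose proof PI_4 as H4.
pose proof PI2_3_2 as H3.
destruct (pre_sin_bound (PI * x) 0) as [Hs _]; [nra|nra|].
eapply Rle_trans; [|exact Hs].
unfold sin_approx, sin_term. simpl.
set (y := PI * x). assert (Hy : 0 <= y <= 2) by (unfold y; nra).
assert (Hxy : x <= y / 3) by (unfold y; nra).
assert (Hc : y * (y * y) <= y * 4) by (apply Rmult_le_compat_l; nra).
lra.
Qed.

(** The square of the sine is [(1 - cs b) / 2], which is even and 1-periodic, so [b] may be replaced
    by its distance to a nearest integer. *)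
Lemma sqr_dist_int_le b : exists z, (b - IZR z) ^ 2 <= sin (PI * b) ^ 2.
Proof.
destruct (near_int_half b) as [z Hz]. exists z.
set (u := b - IZR z) in *.
assert (Hd : forall y, sin (PI * y) ^ 2 = (1 - cs y) / 2).
{ intros y. unfold cs. replace (2 * PI * y) with (2 * (PI * y)) by ring.
  rewrite cos_2a_sin. field. }
assert (Hb : sin (PI * b) ^ 2 = sin (PI * Rabs u) ^ 2).
{ rewrite !Hd. f_equal; f_equal.
  replace b with (u + IZR z) by (unfold u; ring). rewrite cs_period.
  unfold Rabs; destruct (Rcase_abs u); [now rewrite cs_opp|reflexivity]. }
rewrite Hb, <- (pow2_abs u). apply pow_incr.
split; [apply Rabs_pos|]. apply half_le_sin. split; [apply Rabs_pos|exact Hz].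
Qed.

(** The sum is compared with its averages over windows of length [H]. Cauchy-Schwarz and expansion
    of the squares leave correlations at lags below [H]. Only their real parts enter, so an upper
    bound without absolute values suffices. *)
Lemma van_der_corput (g : nat -> R) (N H : nat) (c : R) :
  0 <= c ->
  (forall d s, (1 <= d < H)%nat ->
     lsum (fun n => cs (g (n + s + d)%nat - g (n + s)%nat)) (seq 0 N) <= c) ->
  INR H ^ 2 * modsq g (seq 0 N) <=
  2 * INR N * (INR H * INR N + INR H ^ 2 * c) + 16 * INR H ^ 4.
Proof.
intros Hc0 Hc.
(* Each unit shift changes only the two boundary terms, which costs at most 2. *)
assert (Hshift : forall f : nat -> R, (forall n, -1 <= f n <= 1) -> forall h,
  Rabs (lsum f (seq 0 N) - lsum (fun n => f (n + h)%nat) (seq 0 N)) <= 2 * INR h).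
{ intros f Hf. induction h as [|h IH].
  - rewrite (lsum_ext (fun n => f (n + 0)%nat) f) by (intros; f_equal; lia).
    rewrite Rminus_diag, Rabs_R0; simpl; lra.
  - assert (Ht : forall M, lsum (fun n => f (n + S h)%nat) (seq 0 M) -
        lsum (fun n => f (n + h)%nat) (seq 0 M) = f (M + h)%nat - f h).
    { induction M as [|M IHM]; [simpl; ring|].
      rewrite !lsum_seq_S. replace (M + S h)%nat with (S M + h)%nat by lia.
      replace (f (S M + h)%nat) with (f (M + S h)%nat) in * by (f_equal; lia). lra. }
    specialize (Ht N). pose proof (Hf (N + h)%nat). pose proof (Hf h).
    rewrite S_INR. apply Rabs_le_inv in IH. apply Rabs_le. lra. }
assert (Havg : forall f : nat -> R, (forall n, -1 <= f n <= 1) ->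
  INR H ^ 2 * (lsum f (seq 0 N) * lsum f (seq 0 N)) <=
  2 * (INR N * lsum (fun n => lsum (fun h => f (n + h)%nat) (seq 0 H) *
                              lsum (fun h => f (n + h)%nat) (seq 0 H)) (seq 0 N))
  + 8 * INR H ^ 4).
{ intros f Hf.
  set (P := lsum (fun n => lsum (fun h => f (n + h)%nat) (seq 0 H)) (seq 0 N)).
  assert (HP : P * P <= INR N * lsum (fun n => lsum (fun h => f (n + h)%nat) (seq 0 H) *
                              lsum (fun h => f (n + h)%nat) (seq 0 H)) (seq 0 N)).
  { pose proof (lsum_cauchy_schwarz
      (fun n => lsum (fun h => f (n + h)%nat) (seq 0 H)) (seq 0 N)) as HC.
    rewrite length_seq in HC. exact HC. }
  assert (HE : Rabs (INR H * lsum f (seq 0 N) - P) <= 2 * INR H ^ 2).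
  { unfold P. rewrite lsum_swap.
    replace (INR H * lsum f (seq 0 N)) with (lsum (fun _ => lsum f (seq 0 N)) (seq 0 H))
      by (rewrite lsum_const, length_seq; reflexivity).
    rewrite <- lsum_minus.
    replace (2 * INR H ^ 2) with (INR (length (seq 0 H)) * (2 * INR H))
      by (rewrite length_seq; ring).
    apply lsum_abs_le. intros h Hh. apply in_seq in Hh.
    eapply Rle_trans; [apply Hshift, Hf|].
    apply Rmult_le_compat_l; [lra|apply le_INR; lia]. }
  apply Rabs_le_inv in HE. set (S := lsum f (seq 0 N)) in *.
  set (e := INR H * S - P) in *.
  assert (He : e * e <= (2 * INR H ^ 2) * (2 * INR H ^ 2)) by nra.
  replace (INR H ^ 2 * (S * S)) with ((P + e) * (P + e)) by (unfold e; ring).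
  assert (Hpe : (P + e) * (P + e) <= 2 * (P * P) + 2 * (e * e))
    by (pose proof (Rle_0_sqr (P - e)) as Hs; unfold Rsqr in Hs; lra).
  replace (8 * INR H ^ 4) with (2 * ((2 * INR H ^ 2) * (2 * INR H ^ 2))) by ring.
  lra. }
pose proof (Havg (fun n => cs (g n)) (fun n => cs_bound _)) as H1.
pose proof (Havg (fun n => sn (g n)) (fun n => sn_bound _)) as H2.
(* The diagonal [h = h'] contributes [INR H * INR N]. Every other pair is a correlation at lag
   [|h - h'|], the order being irrelevant because [cs] is even. *)
assert (HM : lsum (fun n => modsq (fun h => g (n + h)%nat) (seq 0 H)) (seq 0 N)
   <= INR H * INR N + INR H ^ 2 * c).
{ apply Rle_trans with (lsum (fun h => lsum (fun h' =>
     c + (if Nat.eq_dec h h' then INR N else 0)) (seq 0 H)) (seq 0 H)).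
  - rewrite (lsum_ext _ _ _ (fun n _ => modsq_expand (fun h => g (n + h)%nat) (seq 0 H))).
    rewrite lsum_swap. apply lsum_le; intros h Hh. apply in_seq in Hh.
    rewrite lsum_swap. apply lsum_le; intros h' Hh'. apply in_seq in Hh'.
    destruct (Nat.eq_dec h h') as [<-|Hne].
    + rewrite (lsum_ext _ (fun _ => 1)).
      * rewrite lsum_const, length_seq; lra.
      * intros n _. rewrite Rminus_diag; apply cs_0.
    + rewrite Rplus_0_r. destruct (Nat.lt_ge_cases h' h) as [Hlt|Hge].
      * eapply Rle_trans; [|apply (Hc (h - h')%nat h'); lia].
        apply Req_le, lsum_ext; intros n _. do 3 f_equal; lia.
      * eapply Rle_trans; [|apply (Hc (h' - h)%nat h); lia].
        apply Req_le, lsum_ext; intros n _. rewrite <- cs_opp, Ropp_minus_distr.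
        do 3 f_equal; lia.
  - rewrite (lsum_ext _ (fun h => INR H * c + INR N)).
    + rewrite lsum_const, length_seq. apply Req_le; ring.
    + intros h Hh. rewrite lsum_plus, lsum_const, length_seq. f_equal.
      assert (Hd : forall M, lsum (fun h' => if Nat.eq_dec h h' then INR N else 0) (seq 0 M)
         = if Nat.ltb h M then INR N else 0).
      { induction M as [|M IHM]; [reflexivity|]. rewrite lsum_seq_S, IHM.
        destruct (Nat.ltb_spec h M), (Nat.ltb_spec h (S M)), (Nat.eq_dec h M); try lia; lra. }
      rewrite Hd. apply in_seq in Hh. destruct (Nat.ltb_spec h H); [reflexivity|lia]. }
unfold modsq in HM at 1. rewrite lsum_plus in HM.
pose proof (pos_INR N). unfold modsq. nra.
Qed.

(* If [g] has degree [r + 1] and a large exponential sum, then differencing (van der Corput) gives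
   some [d < H] for which [n => g (n + d) - g n], of degree [r], has a large exponential sum. *)
Lemma weyl (r : nat) (eta : R) : 0 < eta ->
  exists (W : Z) (C : R), (1 <= W)%Z /\ 0 < C /\
  forall (N : nat) (b : R) (g : nat -> R), (1 <= N)%nat -> diff_degree (S r) b g ->
    eta * INR N ^ 2 <= modsq g (seq 0 N) -> near_int (IZR W * b) (C / INR N).
Proof.
revert eta. induction r as [|r IH]; intros eta Heta.
(* In degree 1 the sum is geometric and [(u * INR N) ^ 2 <= 2 / eta] follows, [u] being the offset
   from a nearest integer; adding 1 gives a bound for the square root of [2 / eta]. *)
- exists 1%Z, (2 / eta + 1).
  assert (Hq : 0 < 2 / eta) by (apply Rdiv_lt_0_compat; lra).
  split; [lia|]. split; [lra|]. intros N b g HN Hg Hm.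
  assert (Hgn : forall n, g n = g 0%nat + INR n * b).
  { intros n. pose proof (Hg n 0%nat) as Hn. simpl in Hn. lra. }
  destruct (sqr_dist_int_le b) as [z Hz]. exists z. rewrite Rmult_1_l.
  assert (HN' : 1 <= INR N) by (apply (le_INR 1); exact HN).
  set (u := b - IZR z) in *.
  unfold modsq in Hm.
  rewrite (lsum_ext (fun x => cs (g x)) (fun n => cs (g 0%nat + INR n * b))) in Hm
    by (intros; f_equal; apply Hgn).
  rewrite (lsum_ext (fun x => sn (g x)) (fun n => sn (g 0%nat + INR n * b))) in Hm
    by (intros; f_equal; apply Hgn).
  pose proof (geometric_cs (g 0%nat) b N) as Hcs.
  pose proof (geometric_sn (g 0%nat) b N) as Hsn.
  set (X := lsum (fun n => cs (g 0%nat + INR n * b)) (seq 0 N)) in *.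
  set (Y := lsum (fun n => sn (g 0%nat + INR n * b)) (seq 0 N)) in *.
  set (s := sin (PI * b)) in *.
  assert (HX : (s * X) ^ 2 <= 1).
  { rewrite Hcs. pose proof (sn_bound (g 0%nat + INR N * b - b / 2)).
    pose proof (sn_bound (g 0%nat - b / 2)). nra. }
  assert (HY : (s * Y) ^ 2 <= 1).
  { rewrite Hsn. pose proof (cs_bound (g 0%nat + INR N * b - b / 2)).
    pose proof (cs_bound (g 0%nat - b / 2)). nra. }
  assert (Hs : eta * (u * INR N) ^ 2 <= 2).
  { apply Rle_trans with (s ^ 2 * (eta * INR N ^ 2)).
    - replace (eta * (u * INR N) ^ 2) with (u ^ 2 * (eta * INR N ^ 2)) by ring.
      apply Rmult_le_compat_r; [nra|exact Hz].
    - apply Rle_trans with (s ^ 2 * (X * X + Y * Y)).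
      + apply Rmult_le_compat_l; [nra|exact Hm].
      + nra. }
  assert (Hs' : (u * INR N) ^ 2 <= 2 / eta).
  { apply Rmult_le_reg_l with eta; [lra|].
    replace (eta * (2 / eta)) with 2 by (field; lra). exact Hs. }
  apply Rmult_le_reg_r with (INR N); [lra|].
  replace ((2 / eta + 1) / INR N * INR N) with (2 / eta + 1) by (field; lra).
  rewrite <- (Rabs_pos_eq (INR N)) by lra. rewrite <- Rabs_mult.
  apply Rabs_le. nra.
(* If all correlations were at most [eta / 8 * INR N], the three terms of the van der Corput bound
   would stay below a quarter, a quarter and a half of [INR H ^ 2 * (eta * INR N ^ 2)]. The choice
   of [H] handles the diagonal term, [N > N0] the term [16 * INR H ^ 4]. *)
- destruct (INR_archimed eta 8 Heta) as [H HH].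
  destruct (IH ((eta / 8) ^ 2)) as (W & C & HW & HC & HWC); [nra|].
  destruct (INR_archimed eta (32 * INR H ^ 2 + 1) Heta) as [N0 HN0].
  assert (HHp : 1 <= INR H).
  { apply (le_INR 1). destruct H; [simpl in HH; lra|lia]. }
  assert (HF : 0 < INR (fact H)) by (apply lt_0_INR, lt_O_fact).
  (* The lag [d] that differencing yields is unknown but divides [fact H], so this multiplier serves
     all lags. The summand [INR N0] makes the claim trivial for [N <= N0]. *)
  exists (W * Z.of_nat (fact H))%Z, (INR (fact H) * C + INR N0).
  split; [pose proof (lt_O_fact H); nia|].
  pose proof (pos_INR N0) as HN0p.
  split; [nra|]. intros N b g HN Hg Hm.
  assert (HN' : 1 <= INR N) by (apply (le_INR 1); exact HN).
  destruct (Rle_lt_dec (INR N) (INR N0)) as [Hsmall|Hlarge].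
  { eapply near_int_weaken; [apply near_int_half|].
    apply Rmult_le_reg_r with (INR N); [lra|].
    replace ((INR (fact H) * C + INR N0) / INR N * INR N)
      with (INR (fact H) * C + INR N0) by (field; lra). nra. }
  assert (Hex : exists d s, (1 <= d < H)%nat /\
     eta / 8 * INR N < lsum (fun n => cs (g (n + s + d)%nat - g (n + s)%nat)) (seq 0 N)).
  { apply NNPP. intros Hno.
    assert (Hv := van_der_corput g N H (eta / 8 * INR N)).
    assert (INR H ^ 2 * (eta * INR N ^ 2) <=
      2 * INR N * (INR H * INR N + INR H ^ 2 * (eta / 8 * INR N)) + 16 * INR H ^ 4).
    { eapply Rle_trans; [apply Rmult_le_compat_l; [nra|exact Hm]|].
      apply Hv; [nra|]. intros d s Hd. apply Rnot_lt_le. intros Hlt.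
      apply Hno. now exists d, s. }
    set (x := INR H) in *. set (y := INR N) in *.
    assert (Hy : 32 * x ^ 2 < eta * y ^ 2).
    { assert (eta * y <= eta * y ^ 2) by (apply Rmult_le_compat_l; nra).
      assert (INR N0 * eta <= y * eta) by (apply Rmult_le_compat_r; lra). lra. }
    assert (Hy0 : 0 < y ^ 2) by nra.
    assert (Hx1 : x * y ^ 2 * 8 < x * y ^ 2 * (x * eta))
      by (apply Rmult_lt_compat_l; [apply Rmult_lt_0_compat|]; lra).
    assert (Hx2 : x ^ 2 * (32 * x ^ 2) < x ^ 2 * (eta * y ^ 2))
      by (apply Rmult_lt_compat_l; nra).
    lra. }
  destruct Hex as (d & s & Hd & Hlt).
  assert (Hdiv : exists q, fact H = (q * d)%nat).
  { clear - Hd. induction H as [|H IHH]; [lia|].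
    destruct (Nat.eq_dec d (S H)) as [->|Hne].
    - exists (fact H). rewrite fact_simpl; lia.
    - destruct (Nat.eq_dec d H) as [->|Hne'].
      + destruct H as [|H]; [lia|]. exists (S (S H) * fact H)%nat. rewrite !fact_simpl; lia.
      + destruct IHH as [q Hq]; [lia|]. exists (S H * q)%nat. rewrite fact_simpl, Hq; lia. }
  destruct Hdiv as [q Hq].
  assert (Hgd : diff_degree (S r) (INR d * b)
    (fun n => g (n + s + d)%nat - g (n + s)%nat))
    by exact (diff_degree_shift (S r) s _ _ (Hg d)).
  assert (Hn := HWC N _ _ HN Hgd).
  assert (Hm' : (eta / 8) ^ 2 * INR N ^ 2 <=
     modsq (fun n => g (n + s + d)%nat - g (n + s)%nat) (seq 0 N)).
  { unfold modsq.
    set (X := lsum (fun n => cs (g (n + s + d)%nat - g (n + s)%nat)) (seq 0 N)) in *.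
    set (Y := lsum _ _). pose proof (Rle_0_sqr Y) as HY; unfold Rsqr in HY.
    rewrite <- Rpow_mult_distr. set (t := eta / 8 * INR N) in *.
    assert (0 < t) by (unfold t; nra). nra. }
  specialize (Hn Hm'). apply (near_int_mult (Z.of_nat q)) in Hn.
  rewrite <- INR_IZR_INZ in Hn. rewrite (Rabs_pos_eq (INR q)) in Hn by apply pos_INR.
  replace (IZR (W * Z.of_nat (fact H)) * b) with (INR q * (IZR W * (INR d * b))).
  2:{ rewrite mult_IZR, <- INR_IZR_INZ, Hq, mult_INR. ring. }
  eapply near_int_weaken; [exact Hn|].
  unfold Rdiv. rewrite <- Rmult_assoc.
  apply Rmult_le_compat_r; [left; apply Rinv_0_lt_compat; lra|].
  assert (INR q <= INR (fact H)) by (apply le_INR; nia). nra.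
Qed.

(** A real part below [- eps * INR N] forces a squared modulus of at least [eps ^ 2 * INR N ^ 2], so
    [weyl] applies; the factorial and the leading coefficient are absorbed into [W]. *)
Lemma polynomial_sum_dichotomy (a : list Z) (ar : Z) (n0 : nat) (eps : R) :
  (1 <= length a)%nat -> (1 <= ar)%Z -> 0 < eps ->
  exists (W : Z) (C : R), (1 <= W)%Z /\ 0 < C /\
  forall (N : nat) (al : R), (1 <= N)%nat ->
    - eps * INR N <=
      lsum (fun n => cs (al * zpoly_eval (a ++ ar :: nil) (INR (n + n0)))) (seq 0 N)
    \/ near_int (IZR W * al) (C / INR N).
Proof.
intros Ha Har Heps.
destruct (length a) as [|r] eqn:Hr; [lia|].
destruct (weyl r (eps ^ 2)) as (W & C & HW & HC & H); [nra|].
pose proof (lt_O_fact (S r)) as Hf.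
exists (W * (Z.of_nat (fact (S r)) * ar))%Z, C.
split; [nia|]. split; [exact HC|]. intros N al HN.
set (X := lsum _ _).
destruct (Rle_lt_dec (- eps * INR N) X) as [HX|HX]; [now left|right].
pose proof (diff_degree_zpoly al a ar) as Hg. rewrite Hr in Hg.
apply (diff_degree_shift _ n0) in Hg. simpl in Hg.
rewrite 2!mult_IZR, <- INR_IZR_INZ.
replace (IZR W * (INR (fact (S r)) * IZR ar) * al)
  with (IZR W * (INR (fact (S r)) * (al * IZR ar))) by ring.
apply H with (2 := Hg); [exact HN|].
unfold modsq. fold X. set (Y := lsum _ _).
pose proof (Rle_0_sqr Y) as HY; unfold Rsqr in HY. rewrite <- Rpow_mult_distr.
pose proof (pos_INR N). set (t := eps * INR N) in *.
assert (0 <= t) by (apply Rmult_le_pos; lra).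
assert (X < - t) by (unfold t; lra). nra.
Qed.

(** * The recurrence satisfied by a character along powers of [omega] *)

(* [cheb W n] is [W ^ (n - 1) * sin (n * theta) / sin theta], where [cos theta = 1 / (2 * W)]. *)
Fixpoint cheb (W : Z) (n : nat) : Z :=
  match n with
  | O => 0
  | S n' => match n' with
            | O => 1
            | S n'' => cheb W n' - W * W * cheb W n''
            end
  end.

Arguments cheb : simpl never.

Lemma cheb_SS W n : cheb W (S (S n)) = (cheb W (S n) - W * W * cheb W n)%Z.
Proof. reflexivity. Qed.

Lemma cheb_mod W n : exists e, cheb W (S n) = (1 + W * e)%Z.
Proof.
induction n as [|n [e He]].
- exists 0%Z. rewrite Z.mul_0_r. reflexivity.
- exists (e - W * cheb W n)%Z. rewrite cheb_SS, He. ring.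
Qed.

(** This solves the recurrence from its two initial values, the powers of [W] clearing
    denominators. *)
Lemma cheb_recurrence (W : Z) (al : nat -> R) (s : nat) :
  (forall t, (t + 2 <= s)%nat -> IZR W * (al (S (S t)) + al t) = al (S t)) ->
  forall t, (t + 1 <= s)%nat ->
  IZR W ^ S t * al (S t) =
  IZR (cheb W (S t)) * (IZR W * al 1%nat) - IZR W ^ 2 * IZR (cheb W t) * al 0%nat.
Proof.
intros H.
assert (H2 : forall t,
  ((t + 1 <= s)%nat -> IZR W ^ S t * al (S t) =
     IZR (cheb W (S t)) * (IZR W * al 1%nat) - IZR W ^ 2 * IZR (cheb W t) * al 0%nat) /\
  ((t + 2 <= s)%nat -> IZR W ^ S (S t) * al (S (S t)) =
     IZR (cheb W (S (S t))) * (IZR W * al 1%nat)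
       - IZR W ^ 2 * IZR (cheb W (S t)) * al 0%nat)).
{ induction t as [|t [IH1 IH2]].
  - split; intros Ht.
    + change (cheb W 1) with 1%Z; change (cheb W 0) with 0%Z. simpl; ring.
    + assert (Hr := H 0%nat Ht).
      replace (IZR W ^ 2 * al 2%nat)
        with (IZR W * (IZR W * (al 2%nat + al 0%nat)) - IZR W ^ 2 * al 0%nat) by ring.
      rewrite Hr. change (cheb W 2) with (1 - W * W * 0)%Z. change (cheb W 1) with 1%Z.
      rewrite minus_IZR, !mult_IZR. ring.
  - split; intros Ht; [apply IH2; lia|].
    rewrite (cheb_SS W (S t)), minus_IZR, !mult_IZR.
    replace (IZR W ^ S (S (S t)) * al (S (S (S t))))
      with (IZR W ^ S (S t) * (IZR W * (al (S (S (S t))) + al (S t)))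
            - IZR W ^ 2 * (IZR W ^ S t * al (S t))) by (simpl; ring).
    rewrite H by lia. rewrite IH2, IH1 by lia.
    rewrite (cheb_SS W t), !minus_IZR, !mult_IZR. ring. }
intros t Ht. now apply H2.
Qed.

(* Running the recurrence away from the middle index in both directions gives two relations; since
   [cheb W n] is 1 modulo [W] for [n >= 1], combining them isolates the middle term modulo [W]. *)
Lemma middle_combination (W : Z) (p s : nat) :
  exists x y z : Z, forall (al : nat -> R) (i : nat),
  (forall t, (t + 2 <= S p + S s)%nat ->
     IZR W * (al (i + S (S t))%nat + al (i + t)%nat) = al (i + S t)%nat) ->
  al (i + S p)%nat =
    IZR x * (IZR W * al i) + IZR y * (IZR W * al (i + S p)%nat) +
    IZR z * (IZR W * al (i + S p + S s)%nat).
Proof.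
destruct (cheb_mod W p) as [e He]. destruct (cheb_mod W s) as [f Hf].
(* The backward relation is weighted by [cheb W (S s)], the forward one by [cheb W (S p)]. The two
   neighbours then merge into the middle term, with coefficient [cheb W (S p) * cheb W (S s) = 1 + W
   * (e + f + W * e * f)]; all but the 1 goes into [y]. *)
exists (cheb W (S s) * W ^ Z.of_nat p)%Z.
exists (W * (cheb W p * cheb W (S s) + cheb W s * cheb W (S p)) - (e + f + W * e * f))%Z.
exists (cheb W (S p) * W ^ Z.of_nat s)%Z.
intros al i H.
assert (Hm : IZR W * (al (i + S (S p))%nat + al (i + p)%nat) = al (i + S p)%nat)
  by (apply H; lia).
assert (Hfw := cheb_recurrence W (fun t => al (i + S p + t)%nat) (S s)).
assert (Hbw := cheb_recurrence W (fun t => al (i + S p - t)%nat) (S p)).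
cbn beta in Hfw, Hbw.
replace (i + S p + 0)%nat with (i + S p)%nat in Hfw by lia.
replace (i + S p + 1)%nat with (i + S (S p))%nat in Hfw by lia.
replace (i + S p - 0)%nat with (i + S p)%nat in Hbw by lia.
replace (i + S p - 1)%nat with (i + p)%nat in Hbw by lia.
assert (Hfw' := fun Hr => Hfw Hr s). assert (Hbw' := fun Hr => Hbw Hr p).
clear Hfw Hbw. replace (i + S p - S p)%nat with i in Hbw' by lia.
assert (Hf1 : IZR W ^ S s * al (i + S p + S s)%nat =
  IZR (cheb W (S s)) * (IZR W * al (i + S (S p))%nat)
  - IZR W ^ 2 * IZR (cheb W s) * al (i + S p)%nat).
{ apply Hfw'; [|lia]. intros t Ht.
  replace (i + S p + S (S t))%nat with (i + S (S (S p + t)))%nat by lia.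
  replace (i + S p + S t)%nat with (i + S (S p + t))%nat by lia.
  replace (i + S p + t)%nat with (i + (S p + t))%nat by lia. apply H; lia. }
assert (Hb1 : IZR W ^ S p * al i =
  IZR (cheb W (S p)) * (IZR W * al (i + p)%nat)
  - IZR W ^ 2 * IZR (cheb W p) * al (i + S p)%nat).
{ apply Hbw'; [|lia]. intros t Ht. rewrite Rplus_comm.
  replace (i + S p - t)%nat with (i + S (S (p - 1 - t)))%nat by lia.
  replace (i + S p - S t)%nat with (i + S (p - 1 - t))%nat by lia.
  replace (i + S p - S (S t))%nat with (i + (p - 1 - t))%nat by lia. apply H; lia. }
clear Hfw' Hbw' H.
rewrite minus_IZR, !plus_IZR, !mult_IZR, !plus_IZR, !mult_IZR, <- !pow_IZR.
assert (He' : IZR (cheb W (S p)) = 1 + IZR W * IZR e)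
  by (rewrite He, plus_IZR, mult_IZR; reflexivity).
assert (Hf' : IZR (cheb W (S s)) = 1 + IZR W * IZR f)
  by (rewrite Hf, plus_IZR, mult_IZR; reflexivity).
set (u := al (i + S p)%nat) in *. set (v := al (i + S (S p))%nat) in *.
set (v' := al (i + p)%nat) in *. set (w := al (i + S p + S s)%nat) in *.
set (w' := al i) in *. rewrite <- tech_pow_Rmult in Hf1, Hb1.
set (P := IZR W ^ p) in *. set (Q := IZR W ^ s) in *.
replace (IZR (cheb W (S s)) * P * (IZR W * w'))
  with (IZR (cheb W (S s)) * (IZR W * P * w')) by ring.
replace (IZR (cheb W (S p)) * Q * (IZR W * w))
  with (IZR (cheb W (S p)) * (IZR W * Q * w)) by ring.
rewrite Hf1, Hb1, He', Hf'.
assert (Hv : IZR W * v' = u - IZR W * v) by lra.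
rewrite Hv. ring.
Qed.

Lemma eventually_forall_lt (Q : nat -> nat -> Prop) (n : nat) :
  (forall i, (i < n)%nat -> exists M, forall M', (M <= M')%nat -> Q i M') ->
  exists M, forall M', (M <= M')%nat -> forall i, (i < n)%nat -> Q i M'.
Proof.
induction n as [|n IH]; intros H.
- exists 0%nat; intros; lia.
- destruct IH as [M HM]; [intros; apply H; lia|].
  destruct (H n) as [M1 HM1]; [lia|].
  exists (max M M1). intros M' HM' i Hi.
  destruct (Nat.eq_dec i n) as [->|Hne]; [apply HM1; lia|apply HM; lia].
Qed.

(** The integers [x], [y], [z] of [middle_combination] depend only on the two gaps between the
    indices. Finitely many gaps fit below [m], so one [K] dominates them all. *)
Lemma near_int_middle (W : Z) (m : nat) :
  exists K : nat, forall (d : R) (al : nat -> R) (i j l : nat), 0 <= d ->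
  (forall t, (t + 2 < m)%nat -> IZR W * (al (S (S t)) + al t) = al (S t)) ->
  (i < j)%nat -> (j < l)%nat -> (l < m)%nat ->
  near_int (IZR W * al i) d -> near_int (IZR W * al j) d -> near_int (IZR W * al l) d ->
  near_int (al j) (INR K * d).
Proof.
assert (HK : exists K, forall K', (K <= K')%nat -> forall p, (p < m)%nat ->
  forall s, (s < m)%nat ->
  forall (d : R) (al : nat -> R) (i : nat), 0 <= d ->
  (forall t, (t + 2 < m)%nat -> IZR W * (al (S (S t)) + al t) = al (S t)) ->
  (i + S p + S s < m)%nat ->
  near_int (IZR W * al i) d -> near_int (IZR W * al (i + S p)%nat) d ->
  near_int (IZR W * al (i + S p + S s)%nat) d ->
  near_int (al (i + S p)%nat) (INR K' * d)).
{ apply eventually_forall_lt; intros p _. apply eventually_forall_lt; intros s _.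
  destruct (middle_combination W p s) as (x & y & z & Hxyz).
  destruct (INR_archimed 1 (Rabs (IZR x) + Rabs (IZR y) + Rabs (IZR z)) Rlt_0_1) as [K HK].
  exists K. intros K' HK' d al i Hd Hrec Hm Hi Hj Hl.
  apply le_INR in HK'. rewrite Hxyz.
  - eapply near_int_weaken.
    + apply near_int_plus; [apply near_int_plus|]; apply near_int_mult; eassumption.
    + nra.
  - intros t Ht. rewrite !Nat.add_succ_r. apply Hrec. lia. }
destruct HK as [K HK]. exists K. intros d al i j l Hd Hrec Hij Hjl Hlm Hi Hj Hl.
specialize (HK K (le_n K) (j - i - 1)%nat ltac:(lia) (l - j - 1)%nat ltac:(lia) d al i Hd Hrec).
replace (i + S (j - i - 1))%nat with j in HK by lia.
replace (j + S (l - j - 1))%nat with l in HK by lia.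
now apply HK.
Qed.

Definition ind (P : Prop) : R := if excluded_middle_informative P then 1 else 0.

Lemma ind_true (P : Prop) : P -> ind P = 1.
Proof. unfold ind. now destruct (excluded_middle_informative P). Qed.

Lemma ind_nonneg (P : Prop) : 0 <= ind P.
Proof. unfold ind. destruct (excluded_middle_informative P); lra. Qed.

Lemma count_le_1 (P : nat -> Prop) (n : nat) :
  (forall i j, (i < j < n)%nat -> P i -> P j -> False) ->
  lsum (fun i => ind (P i)) (seq 0 n) <= 1.
Proof.
induction n as [|n IH]; intros H; [simpl; lra|].
rewrite lsum_seq_S. unfold ind at 2.
destruct (excluded_middle_informative (P n)) as [Hn|Hn].
- rewrite lsum_zero; [lra|]. intros i Hi. apply in_seq in Hi. unfold ind.
  destruct (excluded_middle_informative (P i)); [|reflexivity].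
  exfalso. apply (H i n); auto; lia.
- rewrite Rplus_0_r. apply IH. intros i j Hij. apply H; lia.
Qed.

Lemma count_le_2 (P : nat -> Prop) (n : nat) :
  (forall i j l, (i < j < l)%nat -> (l < n)%nat -> P i -> P j -> P l -> False) ->
  lsum (fun i => ind (P i)) (seq 0 n) <= 2.
Proof.
induction n as [|n IH]; intros H; [simpl; lra|].
rewrite lsum_seq_S. unfold ind at 2.
destruct (excluded_middle_informative (P n)) as [Hn|Hn].
- assert (lsum (fun i => ind (P i)) (seq 0 n) <= 1); [|lra].
  apply count_le_1. intros i j Hij Hi Hj. apply (H i j n); auto; lia.
- rewrite Rplus_0_r. apply IH. intros i j l Hij Hl. apply H; lia.
Qed.

(** * Averaging over scales *)

Definition exp_sum (F : nat -> Z) (N : nat) (al : R) : R :=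
  lsum (fun n => cs (al * IZR (F n))) (seq 0 N).

(** For [al] close enough to an integer, every phase [al * IZR (F n)] is within a quarter of an
    integer, where the cosine is nonnegative. *)
Lemma exp_sum_near_int (F : nat -> Z) (N : nat) : exists d, 0 < d /\
  forall al, near_int al d -> 0 <= exp_sum F N al.
Proof.
pose (B := 1 + lsum (fun n => Rabs (IZR (F n))) (seq 0 N)).
assert (HB0 : 1 <= B).
{ assert (0 <= lsum (fun n => Rabs (IZR (F n))) (seq 0 N))
    by (apply lsum_nonneg; intros; apply Rabs_pos). unfold B; lra. }
exists (1 / (4 * B)). split; [apply Rdiv_lt_0_compat; lra|].
intros al [z Hz]. apply lsum_nonneg; intros n Hn.
assert (HF : Rabs (IZR (F n)) <= B).
{ pose proof (lsum_ge_term (fun n => Rabs (IZR (F n))) (seq 0 N) n) as Ht.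
  assert (Rabs (IZR (F n)) <= lsum (fun n => Rabs (IZR (F n))) (seq 0 N))
    by (apply Ht; [intros; apply Rabs_pos|exact Hn]). unfold B; lra. }
set (b := al - IZR z) in *.
replace (al * IZR (F n)) with (b * IZR (F n) + IZR (z * F n))
  by (rewrite mult_IZR; unfold b; ring).
rewrite cs_period.
assert (Hb : Rabs (b * IZR (F n)) <= 1 / 4).
{ rewrite Rabs_mult. apply Rle_trans with (1 / (4 * B) * B).
  - apply Rmult_le_compat; auto using Rabs_pos.
  - apply Req_le; field; lra. }
apply Rabs_le_inv in Hb. unfold cs. pose proof PI_RGT_0.
apply cos_ge_0; nra.
Qed.

(** Each scale is chosen so large that [c] divided by it falls below the threshold of
    [exp_sum_near_int] for the preceding scale. *)
Lemma lacunary_scales (F : nat -> Z) (c : R) : exists Ns : nat -> nat, (forall i, (1 <= Ns i)%nat) /\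
  forall i i' al, (i < i')%nat -> near_int al (c / INR (Ns i')) -> 0 <= exp_sum F (Ns i) al.
Proof.
assert (Hnext : forall N, exists N', (N < N')%nat /\
  forall M al, (N' <= M)%nat -> near_int al (c / INR M) -> 0 <= exp_sum F N al).
{ intros N. destruct (exp_sum_near_int F N) as (d & Hd & HE).
  destruct (INR_archimed d c Hd) as [n Hn].
  exists (S N + n)%nat. split; [lia|]. intros M al HM Hal. apply HE.
  eapply near_int_weaken; [exact Hal|].
  assert (HnM : INR n <= INR M) by (apply le_INR; lia).
  assert (HM1 : 1 <= INR M) by (apply (le_INR 1); lia).
  apply Rmult_le_reg_r with (INR M); [lra|].
  replace (c / INR M * INR M) with c by (field; lra). nra. }
set (next := fun N => proj1_sig (constructive_indefinite_description _ (Hnext N))).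
assert (Hnx : forall N, (N < next N)%nat /\
  forall M al, (next N <= M)%nat -> near_int al (c / INR M) -> 0 <= exp_sum F N al)
  by exact (fun N => proj2_sig (constructive_indefinite_description _ (Hnext N))).
exists (fun i => Nat.iter i next 1%nat).
assert (Hmon : forall i i', (i <= i')%nat -> (Nat.iter i next 1 <= Nat.iter i' next 1)%nat).
{ intros i i' Hi. induction Hi as [|i' Hi IH]; [lia|].
  simpl. destruct (Hnx (Nat.iter i' next 1%nat)) as [Hlt _]. lia. }
split.
- intros i. apply (Hmon 0%nat); lia.
- intros i i' al Hi Hal. destruct (Hnx (Nat.iter i next 1%nat)) as [_ HE].
  apply HE with (2 := Hal). apply (Hmon (S i) i'); lia.
Qed.

Lemma exp_sum_ge (F : nat -> Z) (N : nat) (al : R) : - INR N <= exp_sum F N al.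
Proof.
apply Rle_trans with (lsum (fun _ => -1) (seq 0 N)).
- rewrite lsum_const, length_seq; lra.
- apply lsum_le; intros; apply cs_bound.
Qed.

(* At each scale at most two of the [al j] are close to a non-integral multiple of [1 / W]; an [al j]
   close to an integer at some scale gives a nonnegative sum at all smaller scales. *)
Lemma averaged_lower_bound (F : nat -> Z) (W : Z) (C eps : R) (m T : nat) :
  0 < C -> 0 < eps ->
  (forall N al, (1 <= N)%nat ->
     - eps * INR N <= exp_sum F N al \/ near_int (IZR W * al) (C / INR N)) ->
  exists Ns : nat -> nat, (forall i, (1 <= Ns i)%nat) /\
  forall al : nat -> R,
  (forall t, (t + 2 < m)%nat -> IZR W * (al (S (S t)) + al t) = al (S t)) ->
  - (2 * INR T + INR m + eps * INR T * INR m) <=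
  lsum (fun i => lsum (fun j => / INR (Ns i) * exp_sum F (Ns i) (al j)) (seq 0 m)) (seq 0 T).
Proof.
intros HC Heps Hdich.
destruct (near_int_middle W m) as [K HK].
destruct (lacunary_scales F (INR K * C)) as (Ns & HNs & Hsc).
exists Ns. split; [exact HNs|]. intros al Hrec.
(* A normalised term is below [- eps] only for a pair in [bad] or [neg], and never below -1. Pairs
   in [bad] are counted for fixed scale [i], at most two each; pairs in [neg] for fixed [j], at most
   one each. *)
pose (bad i j := near_int (IZR W * al j) (C / INR (Ns i)) /\
                 ~ near_int (al j) (INR K * C / INR (Ns i))).
pose (neg i j := near_int (al j) (INR K * C / INR (Ns i)) /\ exp_sum F (Ns i) (al j) < 0).
apply Rle_trans with
  (lsum (fun i => lsum (fun j => - eps - (ind (bad i j) + ind (neg i j))) (seq 0 m)) (seq 0 T)).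
- rewrite (lsum_ext _ (fun i => - eps * INR m - (lsum (fun j => ind (bad i j)) (seq 0 m) +
                                   lsum (fun j => ind (neg i j)) (seq 0 m)))).
  2:{ intros i _. rewrite lsum_minus, lsum_const, lsum_plus, length_seq. ring. }
  rewrite lsum_minus, lsum_const, lsum_plus, length_seq.
  assert (Hbad : lsum (fun i => lsum (fun j => ind (bad i j)) (seq 0 m)) (seq 0 T)
      <= 2 * INR T).
  { apply Rle_trans with (lsum (fun _ => 2) (seq 0 T)).
    2:{ rewrite lsum_const, length_seq; lra. }
    apply lsum_le; intros i _. apply count_le_2.
    intros j1 j2 j3 Hj Hj3 [H1 _] [H2 Hn] [H3 _]. apply Hn.
    unfold Rdiv. rewrite Rmult_assoc.
    apply HK with (i := j1) (l := j3); try lia; auto.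
    left. apply Rdiv_lt_0_compat; [exact HC|]. apply (lt_INR 0). specialize (HNs i); lia. }
  assert (Hneg : lsum (fun i => lsum (fun j => ind (neg i j)) (seq 0 m)) (seq 0 T)
      <= INR m).
  { rewrite lsum_swap. apply Rle_trans with (lsum (fun _ => 1) (seq 0 m)).
    2:{ rewrite lsum_const, length_seq; lra. }
    apply lsum_le; intros j _. apply count_le_1.
    intros i i' Hi [_ H1] [H2 _]. specialize (Hsc i i' (al j) ltac:(lia) H2). lra. }
  lra.
- apply lsum_le; intros i _. apply lsum_le; intros j _.
  assert (HN : 0 < INR (Ns i)) by (apply (lt_INR 0); specialize (HNs i); lia).
  assert (Hdiv : forall c, c * INR (Ns i) <= exp_sum F (Ns i) (al j) ->
     c <= / INR (Ns i) * exp_sum F (Ns i) (al j)).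
  { intros c Hc. apply Rmult_le_reg_l with (INR (Ns i)); [exact HN|].
    rewrite <- Rmult_assoc, Rinv_r by lra. lra. }
  pose proof (ind_nonneg (bad i j)). pose proof (ind_nonneg (neg i j)).
  destruct (Hdich (Ns i) (al j) (HNs i)) as [Hd|Hd].
  + apply Hdiv in Hd. lra.
  + assert (Hge : -1 <= / INR (Ns i) * exp_sum F (Ns i) (al j))
      by (apply Hdiv; pose proof (exp_sum_ge F (Ns i) (al j)); lra).
    destruct (classic (near_int (al j) (INR K * C / INR (Ns i)))) as [Hn|Hn].
    * destruct (Rlt_le_dec (exp_sum F (Ns i) (al j)) 0) as [Hlt|Hle].
      -- rewrite (ind_true (neg i j)) by (split; assumption). lra.
      -- assert (0 <= / INR (Ns i) * exp_sum F (Ns i) (al j)) by (apply Hdiv; lra). lra.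
    * rewrite (ind_true (bad i j)) by (split; assumption). lra.
Qed.

(** * Fourier analysis on a box *)

Definition grid (P : nat) : list (nat * nat) := list_prod (seq 0 P) (seq 0 P).

(** The value at [v] of the character [xi] of the group of pairs modulo [P], as a fraction of a full
    turn. *)
Definition phase (P : nat) (v : Z * Z) (xi : nat * nat) : R :=
  (IZR (fst v) * INR (fst xi) + IZR (snd v) * INR (snd xi)) / INR P.

Lemma sum_roots_of_unity (P : nat) (r : Z) :
  (Z.abs r < Z.of_nat P)%Z -> r <> 0%Z ->
  lsum (fun a => cs (IZR r * INR a / INR P)) (seq 0 P) = 0 /\
  lsum (fun a => sn (IZR r * INR a / INR P)) (seq 0 P) = 0.
Proof.
intros Hr Hr0.
assert (HP : 0 < INR P) by (apply (lt_INR 0); lia).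
set (b := IZR r / INR P).
assert (HPb : INR P * b = IZR r) by (unfold b; field; lra).
assert (Hpos : forall x, 0 < x < 1 -> 0 < sin (PI * x)).
{ intros x Hx. pose proof PI_RGT_0. apply sin_gt_0; nra. }
assert (Hs : sin (PI * b) <> 0).
{ assert (Hlt : - INR P < IZR r < INR P).
  { rewrite INR_IZR_INZ, <- opp_IZR. split; apply IZR_lt; lia. }
  destruct (Z_lt_le_dec 0 r) as [Hp|Hn].
  - apply IZR_lt in Hp. apply Rgt_not_eq, Hpos. nra.
  - assert (Hn' : IZR r < 0) by (apply IZR_lt; lia).
    replace (PI * b) with (- (PI * - b)) by ring. rewrite sin_neg.
    assert (0 < sin (PI * - b)) by (apply Hpos; nra). lra. }
split; apply Rmult_eq_reg_l with (2 := Hs); rewrite Rmult_0_r.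
- rewrite (lsum_ext _ (fun n => cs (0 + INR n * b)))
    by (intros; f_equal; unfold b; field; lra).
  rewrite geometric_cs, HPb.
  replace (0 + IZR r - b / 2) with (0 - b / 2 + IZR r) by ring.
  rewrite sn_period. lra.
- rewrite (lsum_ext _ (fun n => sn (0 + INR n * b)))
    by (intros; f_equal; unfold b; field; lra).
  rewrite geometric_sn, HPb.
  replace (0 + IZR r - b / 2) with (0 - b / 2 + IZR r) by ring.
  rewrite cs_period. lra.
Qed.

Lemma grid_orthogonality (P : nat) (v : Z * Z) :
  (Z.abs (fst v) < Z.of_nat P)%Z -> (Z.abs (snd v) < Z.of_nat P)%Z -> v <> (0, 0)%Z ->
  lsum (fun xi => cs (phase P v xi)) (grid P) = 0.
Proof.
destruct v as [r s]; simpl. intros Hr Hs Hv.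
assert (HP : 0 < INR P) by (apply (lt_INR 0); lia).
unfold grid. rewrite lsum_list_prod.
rewrite (lsum_ext _ (fun a => lsum (fun b =>
   cs (IZR r * INR a / INR P) * cs (IZR s * INR b / INR P)
   - sn (IZR r * INR a / INR P) * sn (IZR s * INR b / INR P)) (seq 0 P))).
2:{ intros a _. apply lsum_ext; intros b _. rewrite <- cs_plus.
    unfold phase; simpl. f_equal. field; lra. }
rewrite (lsum_ext _ _ _ (fun a _ => lsum_minus _ _ _)), lsum_minus, <- !lsum_mult.
destruct (Z.eq_dec r 0) as [Hr0|Hr0].
- destruct (sum_roots_of_unity P s Hs) as [-> ->]; [congruence|ring].
- destruct (sum_roots_of_unity P r Hr Hr0) as [-> ->]. ring.
Qed.

Definition fourier_sq (P : nat) (A : list (Z * Z)) (xi : nat * nat) : R :=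
  modsq (fun x => phase P x xi) A.

Definition in_box (M : nat) (x : Z * Z) : Prop :=
  (0 <= fst x < Z.of_nat M)%Z /\ (0 <= snd x < Z.of_nat M)%Z.

(** By orthogonality the sum counts, up to a factor, the pairs of [A] differing by [v] or its
    opposite. The modulus is twice the side of the box, so a nonzero difference shifted by at most
    [M] cannot vanish by wrapping around. *)
Lemma fourier_sq_correlation (M : nat) (A : list (Z * Z)) (v : Z * Z) :
  (forall x, In x A -> in_box M x) ->
  (Z.abs (fst v) <= Z.of_nat M)%Z -> (Z.abs (snd v) <= Z.of_nat M)%Z ->
  (forall x y, In x A -> In y A -> y <> (fst x + fst v, snd x + snd v)%Z) ->
  lsum (fun xi => fourier_sq (2 * M) A xi * cs (phase (2 * M) v xi)) (grid (2 * M)) = 0.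
Proof.
intros HA Hv1 Hv2 Hno. set (P := (2 * M)%nat). unfold fourier_sq.
rewrite (lsum_ext _ (fun xi => lsum (fun x => lsum (fun y =>
  / 2 * cs (phase P (fst x - fst y + fst v, snd x - snd y + snd v)%Z xi) +
  / 2 * cs (phase P (fst x - fst y - fst v, snd x - snd y - snd v)%Z xi)) A) A)).
2:{ intros xi _. rewrite modsq_expand, Rmult_comm, <- lsum_scal.
    apply lsum_ext; intros x _. rewrite <- lsum_scal. apply lsum_ext; intros y _.
    replace (phase P (fst x - fst y + fst v, snd x - snd y + snd v)%Z xi)
      with ((phase P x xi - phase P y xi) + phase P v xi)
      by (unfold phase, Rdiv; simpl; rewrite !plus_IZR, !minus_IZR; ring).
    replace (phase P (fst x - fst y - fst v, snd x - snd y - snd v)%Z xi)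
      with ((phase P x xi - phase P y xi) - phase P v xi)
      by (unfold phase, Rdiv; simpl; rewrite !minus_IZR; ring).
    rewrite cs_plus, (cs_minus (_ - _) (phase P v xi)). field. }
rewrite lsum_swap. apply lsum_zero; intros x Hx.
rewrite lsum_swap. apply lsum_zero; intros y Hy.
rewrite lsum_plus, !lsum_scal.
pose proof (HA x Hx) as [Hx1 Hx2]. pose proof (HA y Hy) as [Hy1 Hy2].
rewrite !grid_orthogonality; try (simpl; lia); [ring| |].
- intros Heq. injection Heq as H1 H2. apply (Hno y x Hy Hx).
  rewrite (surjective_pairing x). f_equal; lia.
- intros Heq. injection Heq as H1 H2. apply (Hno x y Hx Hy).
  rewrite (surjective_pairing y). f_equal; lia.
Qed.

Lemma lsum_delta {A} (dec : forall x y : A, {x = y} + {x <> y}) (x : A) (c : R) l :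
  NoDup l -> In x l -> lsum (fun y => if dec x y then c else 0) l = c.
Proof.
intros Hl. induction Hl as [|a l Ha Hl IH]; [contradiction|].
intros [->|Hx]; simpl.
- destruct (dec x x); [|congruence]. rewrite lsum_zero; [ring|].
  intros y Hy. destruct (dec x y); [congruence|reflexivity].
- destruct (dec x a); [congruence|]. rewrite IH by exact Hx. ring.
Qed.

Lemma Zpair_eq_dec (x y : Z * Z) : {x = y} + {x <> y}.
Proof. decide equality; apply Z.eq_dec. Qed.

(** Parseval's identity in a group of order [4 * M ^ 2]. *)
Lemma fourier_sq_total (M : nat) (A : list (Z * Z)) :
  NoDup A -> (forall x, In x A -> in_box M x) ->
  lsum (fourier_sq (2 * M) A) (grid (2 * M)) = INR (length A) * (4 * INR M ^ 2).
Proof.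
intros HN HA. set (P := (2 * M)%nat). unfold fourier_sq.
rewrite (lsum_ext _ _ _ (fun xi _ => modsq_expand _ _)), lsum_swap.
rewrite <- lsum_const. apply lsum_ext; intros x Hx.
rewrite lsum_swap.
rewrite <- (lsum_delta Zpair_eq_dec x (4 * INR M ^ 2) A HN Hx).
apply lsum_ext; intros y Hy.
rewrite (lsum_ext _ (fun xi => cs (phase P (fst x - fst y, snd x - snd y)%Z xi)))
  by (intros xi _; f_equal; unfold phase, Rdiv; simpl; rewrite !minus_IZR; ring).
destruct (Zpair_eq_dec x y) as [<-|Hne].
- rewrite (lsum_ext _ (fun _ => 1)).
  + rewrite lsum_const. unfold grid. rewrite length_prod, length_seq.
    unfold P. rewrite !mult_INR. simpl; ring.
  + intros xi _. unfold phase, Rdiv; simpl. rewrite !Z.sub_diag, !Rmult_0_l, Rplus_0_l,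
      Rmult_0_l. apply cs_0.
- pose proof (HA x Hx) as [Hx1 Hx2]. pose proof (HA y Hy) as [Hy1 Hy2].
  apply grid_orthogonality; try (simpl; lia).
  intros Heq. injection Heq as H1 H2. apply Hne.
  rewrite (surjective_pairing x), (surjective_pairing y). f_equal; lia.
Qed.

Lemma fourier_sq_origin (P : nat) (A : list (Z * Z)) :
  fourier_sq P A (0, 0)%nat = INR (length A) ^ 2.
Proof.
unfold fourier_sq. rewrite modsq_expand.
rewrite (lsum_ext _ (fun _ => INR (length A) * 1)).
- rewrite lsum_const; ring.
- intros x _. rewrite <- lsum_const. apply lsum_ext; intros y _.
  rewrite <- cs_0. f_equal. unfold phase, Rdiv; simpl; ring.
Qed.

Lemma NoDup_list_prod {A B} (l : list A) (l' : list B) :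
  NoDup l -> NoDup l' -> NoDup (list_prod l l').
Proof.
intros Hl Hl'. induction Hl as [|a l Ha Hl IH]; simpl; [constructor|].
apply NoDup_app; [|exact IH|].
- apply Injective_map_NoDup; [intros x y H; congruence|exact Hl'].
- intros [x y] H1 H2. apply in_map_iff in H1. destruct H1 as (z & Hz & _).
  apply in_prod_iff in H2. destruct H2 as [H2 _]. congruence.
Qed.

Lemma pigeonhole_class {A} (col : A -> nat) (k : nat) (l : list A) :
  (forall x, (col x < k)%nat) ->
  exists i, INR (length l) <= INR k * INR (length (filter (fun x => Nat.eqb (col x) i) l)).
Proof.
intros Hcol.
assert (Hlen : forall i, INR (length (filter (fun x => Nat.eqb (col x) i) l)) =
  lsum (fun x => if Nat.eq_dec (col x) i then 1 else 0) l).
{ intros i. induction l as [|x l IH]; [reflexivity|]. simpl lsum. rewrite <- IH.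
  simpl. destruct (Nat.eqb_spec (col x) i), (Nat.eq_dec (col x) i); try congruence.
  - change (INR (S (length (filter (fun x => Nat.eqb (col x) i) l))) =
      1 + INR (length (filter (fun x => Nat.eqb (col x) i) l))). rewrite S_INR; ring.
  - ring. }
assert (Hsum : lsum (fun i => lsum (fun x => if Nat.eq_dec (col x) i then 1 else 0) l)
    (seq 0 k) = INR (length l)).
{ rewrite lsum_swap, <- (Rmult_1_r (INR _)), <- lsum_const. apply lsum_ext; intros x _.
  apply lsum_delta; [apply seq_NoDup|apply in_seq; specialize (Hcol x); lia]. }
destruct l as [|x0 l']; [exists 0%nat; simpl; lra|].
set (l := x0 :: l') in *.
apply NNPP. intros Hno.
assert (Hk : 0 < INR k) by (apply (lt_INR 0); specialize (Hcol x0); lia).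
(* Sizes are natural numbers, so a strict inequality leaves room for the [+ 1] that yields the
   contradiction after summing over the colours. *)
assert (Hlt : lsum (fun i => INR k * lsum (fun x =>
    if Nat.eq_dec (col x) i then 1 else 0) l + 1) (seq 0 k) <=
  lsum (fun _ => INR (length l)) (seq 0 k)).
{ apply lsum_le; intros i _. rewrite <- Hlen, <- mult_INR, <- S_INR.
  apply le_INR. apply Nat.lt_nge. intros Hge. apply Hno. exists i.
  rewrite <- mult_INR. apply le_INR. lia. }
rewrite lsum_plus, lsum_scal, Hsum, !lsum_const, length_seq in Hlt. lra.
Qed.


Lemma lsum_weighted_zero {A B} (S : A -> R) (G : B -> A -> R) l l' :
  (forall i, In i l' -> lsum (fun x => S x * G i x) l = 0) ->
  lsum (fun x => S x * lsum (fun i => G i x) l') l = 0.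
Proof.
intros H. rewrite (lsum_ext _ (fun x => lsum (fun i => S x * G i x) l'))
  by (intros; now rewrite lsum_scal).
rewrite lsum_swap. now apply lsum_zero.
Qed.

(** * The lattice and the colouring *)

(** In Horner form, once the inner value is at least 1, any [x >= 1 + Rabs (IZR a0)] outweighs the
    coefficient [a0]. *)
Lemma zpoly_eventually_ge_1 (a : list Z) (ar : Z) : (1 <= ar)%Z ->
  exists X, forall x, X <= x -> 1 <= zpoly_eval (a ++ ar :: nil) x.
Proof.
intros Har. apply IZR_le in Har. induction a as [|a0 a [X HX]].
- exists 0. intros x _. simpl. lra.
- exists (Rmax X (1 + Rabs (IZR a0))). intros x Hx. simpl.
  pose proof (Rmax_l X (1 + Rabs (IZR a0))). pose proof (Rmax_r X (1 + Rabs (IZR a0))).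
  specialize (HX x ltac:(lra)). pose proof (Rle_abs (- IZR a0)) as H1.
  rewrite Rabs_Ropp in H1. pose proof (Rabs_pos (IZR a0)). nra.
Qed.

Lemma zpoly_eval_integer (cs : list Z) (z : Z) : exists w, zpoly_eval cs (IZR z) = IZR w.
Proof.
induction cs as [|a cs [w Hw]].
- now exists 0%Z.
- exists (a + z * w)%Z. simpl. now rewrite Hw, plus_IZR, mult_IZR.
Qed.

(* Lattice coordinates are relative to the basis [1], [omega = exp (i * theta)] scaled down by
   [W ^ m], as in [embed]; [direction W m j] represents the unit vector [omega ^ (j + 1)]. *)
Definition direction (W : Z) (m j : nat) : Z * Z :=
  (W ^ Z.of_nat (m - j) * (- W * cheb W j), W ^ Z.of_nat (m - j) * cheb W (S j))%Z.

(** The square root is the imaginary part of [omega], whose real part is [1 / (2 * W)]. *)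
Definition embed (W : Z) (m : nat) (x : Z * Z) : R * R :=
  ((IZR (fst x) + IZR (snd x) / (2 * IZR W)) / IZR W ^ m,
   IZR (snd x) * sqrt (1 - / (4 * IZR W ^ 2)) / IZR W ^ m).

(** The left side is the squared modulus of [- W * cheb W j + cheb W (S j) * omega], which is
    [W ^ j] times [omega ^ (j + 1)]. *)
Lemma cheb_norm (W : Z) (j : nat) :
  (cheb W (S j) ^ 2 - cheb W j * cheb W (S j) + W ^ 2 * cheb W j ^ 2 =
   W ^ (2 * Z.of_nat j))%Z.
Proof.
induction j as [|j IH].
- change (cheb W 1) with 1%Z; change (cheb W 0) with 0%Z.
  change (2 * Z.of_nat 0)%Z with 0%Z. ring.
- replace (2 * Z.of_nat (S j))%Z with (2 + 2 * Z.of_nat j)%Z by lia.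
  rewrite Z.pow_add_r, <- IH, cheb_SS by lia. ring.
Qed.

(** The identity [omega + 1 / omega = 1 / W] carries over because [phase] is linear in the vector;
    it holds exactly, not just modulo 1. *)
Lemma direction_phase_recurrence (W : Z) (m t P : nat) (xi : nat * nat) :
  (t + 2 < m)%nat ->
  IZR W * (phase P (direction W m (S (S t))) xi + phase P (direction W m t) xi) =
  phase P (direction W m (S t)) xi.
Proof.
intros Ht. unfold phase, direction; cbn [fst snd].
replace (m - t)%nat with (S (S (m - S (S t)))) by lia.
replace (m - S t)%nat with (S (m - S (S t))) by lia.
rewrite (cheb_SS W (S t)), (cheb_SS W t).
rewrite !mult_IZR, !minus_IZR, !mult_IZR, !opp_IZR, <- !pow_IZR. simpl.
unfold Rdiv. ring.
Qed.

Lemma embed_dist (W : Z) (m j : nat) (x : Z * Z) (t : Z) :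
  (1 <= W)%Z -> (j < m)%nat -> (0 <= t)%Z ->
  dist2 (embed W m (fst x + t * fst (direction W m j), snd x + t * snd (direction W m j))%Z)
        (embed W m x) = IZR t.
Proof.
intros HW Hj Ht.
assert (Hw : 1 <= IZR W) by (apply IZR_le; exact HW).
unfold dist2, embed, direction; cbn [fst snd].
assert (Hs : sqrt (1 - / (4 * IZR W ^ 2)) ^ 2 = 1 - / (4 * IZR W ^ 2)).
{ apply pow2_sqrt. assert (/ (4 * IZR W ^ 2) <= / 1) by (apply Rinv_le_contravar; nra). lra. }
set (s := sqrt (1 - / (4 * IZR W ^ 2))) in *.
set (c := cheb W j). set (c' := cheb W (S j)).
assert (Hn : IZR c' ^ 2 - IZR c * IZR c' + IZR W ^ 2 * IZR c ^ 2 = IZR W ^ (2 * j)).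
{ rewrite !pow_IZR, <- !mult_IZR, <- minus_IZR, <- plus_IZR. f_equal.
  rewrite Nat2Z.inj_mul. apply cheb_norm. }
rewrite !plus_IZR, !mult_IZR, !opp_IZR, <- !pow_IZR. fold c c'.
set (w := IZR W) in *.
assert (Hwm : w ^ m = w ^ (m - j) * w ^ j) by (rewrite <- pow_add; f_equal; lia).
assert (Hp : 0 < w ^ (m - j)) by (apply pow_lt; lra).
assert (Hq : 0 < w ^ j) by (apply pow_lt; lra).
rewrite (Nat.mul_comm 2), pow_mult in Hn.
apply IZR_le in Ht.
transitivity (sqrt (IZR t ^ 2)); [f_equal|rewrite <- Rsqr_pow2; now apply sqrt_Rsqr].
rewrite Hwm. set (p := w ^ (m - j)) in *. set (q := w ^ j) in *.
set (A1 := _ - _). replace A1 with (IZR t * (- w * IZR c + IZR c' / (2 * w)) / q)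
  by (unfold A1; field; lra).
set (A2 := _ - _). replace A2 with (IZR t * (IZR c' * s) / q) by (unfold A2; field; lra).
transitivity (IZR t ^ 2 / q ^ 2 *
  ((- w * IZR c + IZR c' / (2 * w)) ^ 2 + IZR c' ^ 2 * s ^ 2)); [field; lra|].
rewrite Hs. transitivity (IZR t ^ 2 / q ^ 2 *
  (IZR c' ^ 2 - IZR c * IZR c' + w ^ 2 * IZR c ^ 2)); [field; lra|].
rewrite Hn. field; lra.
Qed.

(* f(x) = a_0 + a_1 x + ... + a_r x^r, coefficients (a_0 :: ... :: a_r),
   r >= 1 (non-constant since a_r >= 1), a_r = last coefficient >= 1.
   A colouring with finitely many colours: c : R*R -> nat with values < k. *)
Theorem theorem1 (a : list Z) (ar : Z)
  (hdeg : (1 <= length a)%nat) (hlead : (1 <= ar)%Z)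
  (k : nat) (c : R * R -> nat) (hc : forall p, (c p < k)%nat) :
  exists (p q : R * R) (n : Z),
    p <> q /\ c p = c q /\ dist2 p q = zpoly_eval (a ++ ar :: nil) (IZR n).
Proof.
apply NNPP. intros Hno.
assert (Hk : 1 <= INR k) by (apply (le_INR 1); specialize (hc (0, 0)); lia).
(* With [m] directions and [m] scales, [kappa] below is [3 * m + eps * m ^ 2 = 108 * k]. The final
   contradiction needs [m ^ 2 + kappa > 4 * k * kappa], that is
   [576 * k ^ 2 + 108 * k > 432 * k ^ 2]. *)
set (m := (24 * k)%nat).
set (eps := 1 / (16 * INR k)).
assert (Heps : 0 < eps) by (apply Rdiv_lt_0_compat; lra).
assert (Hm : INR m = 24 * INR k) by (unfold m; rewrite mult_INR; simpl; ring).
destruct (zpoly_eventually_ge_1 a ar hlead) as [X HX].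
(* Starting the polynomial at [n0] keeps all its values at least 1, so they are distances between
   distinct points. *)
destruct (INR_archimed 1 X Rlt_0_1) as [n0 Hn0].
assert (HF : forall n, exists w,
  zpoly_eval (a ++ ar :: nil) (INR (n + n0)) = IZR w /\ (1 <= w)%Z).
{ intros n. destruct (zpoly_eval_integer (a ++ ar :: nil) (Z.of_nat (n + n0))) as [w Hw].
  rewrite <- INR_IZR_INZ in Hw. exists w. split; [exact Hw|].
  apply le_IZR. rewrite <- Hw. apply HX. rewrite plus_INR. pose proof (pos_INR n). lra. }
set (F := fun n => proj1_sig (constructive_indefinite_description _ (HF n))).
assert (HFv : forall n, zpoly_eval (a ++ ar :: nil) (INR (n + n0)) = IZR (F n))
  by (intros n; exact (proj1 (proj2_sig (constructive_indefinite_description _ (HF n))))).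
assert (HF1 : forall n, (1 <= F n)%Z)
  by (intros n; exact (proj2 (proj2_sig (constructive_indefinite_description _ (HF n))))).
clearbody F. clear HF.
destruct (polynomial_sum_dichotomy a ar n0 eps hdeg hlead Heps) as (W & C & HW & HC & Hd).
destruct (averaged_lower_bound F W C eps m m HC Heps) as (Ns & HNs & Hlow).
{ intros N al HN. destruct (Hd N al HN) as [H|H]; [left|now right].
  unfold exp_sum. erewrite lsum_ext; [exact H|]. intros n _. simpl. now rewrite HFv. }
set (edge := fun j n => (F n * fst (direction W m j), F n * snd (direction W m j))%Z).
(* Finitely many edges occur, so some box is as large as all of them. *)
assert (HM : exists M, forall M', (M <= M')%nat -> forall i, (i < m)%nat ->
  forall j, (j < m)%nat -> forall n, (n < Ns i)%nat ->
  (Z.abs (fst (edge j n)) <= Z.of_nat M')%Z /\ (Z.abs (snd (edge j n)) <= Z.of_nat M')%Z).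
{ apply eventually_forall_lt; intros i _. apply eventually_forall_lt; intros j _.
  apply eventually_forall_lt; intros n _.
  exists (Z.to_nat (Z.abs (fst (edge j n)) + Z.abs (snd (edge j n)))). intros M' HM'. lia. }
destruct HM as [M0 HM0]. set (M := S M0). specialize (HM0 M ltac:(unfold M; lia)).
set (col := fun x => c (embed W m x)).
set (box := list_prod (map Z.of_nat (seq 0 M)) (map Z.of_nat (seq 0 M))).
destruct (pigeonhole_class col k box) as [i0 Hi0]; [intros; apply hc|].
set (A := filter _ box) in Hi0.
assert (Hbox : INR (length box) = INR M ^ 2).
{ unfold box. rewrite length_prod, !length_map, length_seq, mult_INR. ring. }
rewrite Hbox in Hi0.
assert (HAcol : forall x, In x A -> col x = i0).
{ intros x Hx. apply filter_In in Hx. now apply Nat.eqb_eq. }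
assert (HAbox : forall x, In x A -> in_box M x).
{ intros [x y] Hx. apply filter_In in Hx. destruct Hx as [Hx _].
  apply in_prod_iff in Hx. rewrite !in_map_iff in Hx.
  destruct Hx as [(u & <- & Hu) (v & <- & Hv)].
  apply in_seq in Hu. apply in_seq in Hv. split; simpl; lia. }
assert (HAnd : NoDup A).
{ apply NoDup_filter, NoDup_list_prod; apply Injective_map_NoDup;
    try apply seq_NoDup; intros x y; apply Nat2Z.inj. }
set (P := (2 * M)%nat). set (f := fourier_sq P A).
set (Phi := fun xi => lsum (fun i => lsum (fun j =>
   / INR (Ns i) * exp_sum F (Ns i) (phase P (direction W m j) xi)) (seq 0 m)) (seq 0 m)).
(* Two points of [A] differing by an edge would have the same colour and a value of the polynomial
   as distance. Hence every correlation making up [Phi] vanishes. *)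
assert (Hzero : lsum (fun xi => f xi * Phi xi) (grid P) = 0).
{ apply lsum_weighted_zero; intros i Hi. apply lsum_weighted_zero; intros j Hj.
  apply in_seq in Hi. apply in_seq in Hj.
  rewrite (lsum_ext _ (fun xi => / INR (Ns i) *
    (f xi * exp_sum F (Ns i) (phase P (direction W m j) xi)))) by (intros; ring).
  rewrite lsum_scal. unfold exp_sum. rewrite lsum_weighted_zero; [ring|].
  intros n Hn. apply in_seq in Hn.
  rewrite (lsum_ext _ (fun xi => f xi * cs (phase P (edge j n) xi))).
  2:{ intros xi _. do 2 f_equal. unfold phase, edge, Rdiv; simpl.
      rewrite !mult_IZR. ring. }
  destruct (HM0 i ltac:(lia) j ltac:(lia) n ltac:(lia)) as [H1 H2].
  apply fourier_sq_correlation; auto. intros x y Hx Hy Hxy. apply Hno.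
  assert (Hdist := embed_dist W m j x (F n) HW ltac:(lia) ltac:(specialize (HF1 n); lia)).
  exists (embed W m y), (embed W m x), (Z.of_nat (n + n0)).
  rewrite <- INR_IZR_INZ, HFv, Hxy. unfold edge; cbn [fst snd].
  repeat split.
  - intros Heq. rewrite Heq in Hdist. unfold dist2 in Hdist.
    rewrite !Rminus_diag, pow_ne_zero, Rplus_0_r, sqrt_0 in Hdist by lia.
    apply eq_IZR in Hdist. specialize (HF1 n). lia.
  - change (col (fst x + fst (edge j n), snd x + snd (edge j n))%Z = col x).
    rewrite <- Hxy, !HAcol; auto.
  - exact Hdist. }
set (kappa := 2 * INR m + INR m + eps * INR m * INR m) in *.
assert (Hge : forall xi, 0 <= f xi * (Phi xi + kappa)).
{ intros xi. apply Rmult_le_pos; [apply modsq_nonneg|].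
  assert (- kappa <= Phi xi); [|lra].
  apply (Hlow (fun j => phase P (direction W m j) xi)).
  intros t Ht. now apply direction_phase_recurrence. }
(* The ratio bound: all terms [f xi * (Phi xi + kappa)] are nonnegative, so the trivial character
   alone is bounded by their total, which is [kappa] times the sum of [f]. *)
assert (Horig : f (0, 0)%nat * (Phi (0, 0)%nat + kappa) <=
   INR (length A) * (4 * INR M ^ 2) * kappa).
{ rewrite <- (fourier_sq_total M A HAnd HAbox). fold P f.
  eapply Rle_trans.
  - apply (lsum_ge_term (fun xi => f xi * (Phi xi + kappa)) (grid P)); [auto|].
    apply in_prod; apply in_seq; unfold P, M; lia.
  - rewrite (lsum_ext _ (fun xi => f xi * Phi xi + kappa * f xi)) by (intros; ring).
    rewrite lsum_plus, Hzero, lsum_scal. lra. }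
assert (HPhi0 : Phi (0, 0)%nat = INR m * INR m).
{ unfold Phi. rewrite (lsum_ext _ (fun _ => INR m)).
  - rewrite lsum_const, length_seq; reflexivity.
  - intros i _. rewrite (lsum_ext _ (fun _ => 1)).
    + rewrite lsum_const, length_seq; ring.
    + intros j _. unfold exp_sum. rewrite (lsum_ext _ (fun _ => 1)).
      * rewrite lsum_const, length_seq. field. apply not_0_INR. specialize (HNs i). lia.
      * intros n _. rewrite <- cs_0. f_equal. unfold phase, Rdiv; simpl; ring. }
rewrite HPhi0 in Horig. unfold f in Horig. rewrite fourier_sq_origin in Horig.
assert (HMp : 0 < INR M) by (apply (lt_INR 0); unfold M; lia).
assert (Hkappa : kappa = 108 * INR k).
{ unfold kappa, eps. rewrite Hm. field. lra. }
rewrite Hkappa, Hm in Horig.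
set (l := INR (length A)) in *. set (K := INR k) in *.
assert (Hl : 0 < l).
{ assert (0 < K * l) by nra. apply Rmult_lt_reg_l with K; lra. }
(* One factor [l] is cancelled and [INR M ^ 2] replaced by its pigeonhole bound [K * l]; the 4 is
   the ratio of the group order to the size of the box. *)
assert (Horig' : l * (576 * K ^ 2 + 108 * K) <= 4 * (K * l) * (108 * K)).
{ apply Rmult_le_reg_l with l; [exact Hl|].
  eapply Rle_trans; [|eapply Rle_trans; [exact Horig|]]; nra. }
assert (0 < l * K ^ 2) by nra. nra.
Qed.
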